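(* Let $(\alpha_n;M_n)_{n\in\mathbb N}$ be a semi-fast convergent sequence and let $E=E(\alpha_n;M_n)$ be the corresponding symmetric Cantor set. Then $E$ is uniquely achievable if and only if $(\alpha_n;M_n)_{n\in\mathbb N}$ is irreducible and $M_n\le 2$ for all $n\in\mathbb N$.
   Context: All sequences are infinite, summable sequences of positive real numbers arranged in non-increasing order, indexed by $\mathbb N=\{1,2,\dots\}$. The achievement set of $(y_i)$ is $E(y_i)=\{\sum_{i\in A}y_i : A\subset\mathbb N\}$. A non-increasing sequence $(y_i)$ of positive terms converging to $0$ is semi-fast convergent if $y_n>\sum_{i:\,y_i<y_n}y_i$ for all $n\in\mathbb N$. If $(\alpha_p)_{p\in\mathbb N}$ is the strictly decreasing sequence of all values of $(y_i)$ and $M_p\in\{1,2,\dots\}$ is the number of indices $i$ with $y_i=\alpha_p$, one writes $(y_i)=(\alpha_p;M_p)_{p\in\mathbb N}$ and $E(\alpha_p;M_p)=E(y_i)$. Thus semi-fast convergence means $\alpha_p>\sum_{j>p}\alpha_jM_j$ for all $p$. Symmetric Cantor sets are obtained from a closed interval $I_0$ as follows: given integers $n_k\ge2$ and numbers $c_k>0$ with $n_kc_k<1$, at step $k$ one removes from each component $J$ of $I_{k-1}$ exactly $n_k-1$ open intervals of equal length, so that $n_k$ closed intervals, each of length $c_k|J|$, remain; their union over all $J$ is $I_k$, and the symmetric Cantor set is $\bigcap_kI_k$. The symmetric Cantor sets with left endpoint $0$ are exactly the sets $E(\alpha_p;M_p)$ for semi-fast convergent sequences $(\alpha_p;M_p)$,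 with $M_k=n_k-1$. A semi-fast convergent sequence $(\alpha_n;M_n)$ is irreducible if $\alpha_n\neq(M_{n+1}+1)\alpha_{n+1}$ for all $n\in\mathbb N$. An achievement set $E=E(y_i)$ is uniquely achievable if there is no summable, positive, non-increasing sequence $(x_i)\neq(y_i)$ with $E(x_i)=E(y_i)$. *)

(* Defs.v *)
From HB Require Import structures.
From mathcomp Require Import all_boot all_order all_algebra.
From mathcomp Require Import all_classical all_reals all_analysis.
Import Order.TTheory GRing.Theory Num.Theory.
Import numFieldNormedType.Exports.

Set Implicit Arguments.
Unset Strict Implicit.
Unset Printing Implicit Defensive.

Local Open Scope classical_set_scope.
Local Open Scope ring_scope.

(* Sequences are indexed from 0 rather than from 1. *)

Definition positive_seq (R : realType) (y : nat -> R) : Prop :=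
  forall i, 0 < y i.

Definition summable_positive_noninc (R : realType) (y : nat -> R) : Prop :=
  [/\ positive_seq y, nonincreasing_seq y & cvgn (series y)].

(* The sum over the index set A is taken in the extended reals; it is the
   usual (order-independent) sum since it is only used for positive terms. *)
Definition achievement_set (R : realType) (y : nat -> R) : set R :=
  [set x | exists A : set nat, x%:E = \esum_(i in A) (y i)%:E].

(* The tail sum is an extended real, so the strict inequality also asserts
   that it is finite. *)
Definition semi_fast (R : realType) (y : nat -> R) : Prop :=
  [/\ positive_seq y, nonincreasing_seq y, y @ \oo --> (0 : R) &
      forall n, (\esum_(i in [set i | (y i < y n)%R]) (y i)%:E < (y n)%:E)%E].

(* y = (alpha_p; M_p)_p: alpha lists the values of y in decreasing order and
   M p is the multiplicity of the value alpha p. *)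
Definition values_multiplicities (R : realType) (y : nat -> R)
    (alpha : nat -> R) (M : nat -> nat) : Prop :=
  [/\ decreasing_seq alpha, range alpha = range y &
      forall p, ([set i | y i = alpha p] #= `I_(M p))%card].

Definition irreducible_seq (R : realType) (alpha : nat -> R) (M : nat -> nat)
    : Prop :=
  forall n, alpha n <> (M n.+1).+1%:R * alpha n.+1.

Definition uniquely_achievable (R : realType) (y : nat -> R) : Prop :=
  ~ exists x : nat -> R,
      [/\ summable_positive_noninc x, x <> y &
          achievement_set x = achievement_set y].

(* Main.v *)
(* Sufficiency. Let [E] be the achievement set of [y] and of another sequence
   [x]. A cut of [y] is an index [n] where its value drops; it is matched if the
   terms [y_i], [i >= n], and the terms of [x] below [y_(n-1)] have the same set
   of subsums. The gap of [E] at a cut is the interval from the tail sum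
   [T_n = y_n + y_(n+1) + ...] to [y_(n-1)]. A cut whose gap is longer than all
   later gaps is matched, since the subsums of the small terms of [x] cannot jump
   over it; there are such cuts arbitrarily far out. Matching then propagates
   from each cut to the previous one: let [b] be the value between the two cuts,
   [m <= 2] its multiplicity and [a] the preceding value. If the terms of [x]
   below [a] had sum at least [a], then combining those that are at least [b]
   with the already matched small subsums would give an element of [E] in one of
   its gaps, unless [a = (m + 1) b], which irreducibility excludes. Once every
   cut is matched, the terms of [x] and [y] between consecutive cuts agree.

   Necessity. If [z] contains [m >= 1] terms equal to [v], then adjoining [v] and
   [m v] to [z] gives the same achievement set as adjoining [(m + 1) v]. For
   [m = 1] this lets one replace two out of three equal terms [v] by [2 v]; for
   [m = M_(n+1)] it lets one split a term [alpha_n = (m + 1) alpha_(n+1)]. *)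

Require Import Defs.
From mathcomp Require Import all_boot all_order all_algebra.
From mathcomp Require Import all_classical all_reals all_analysis.
From mathcomp Require Import ring lra zify.
Import Order.TTheory GRing.Theory Num.Theory.
Import numFieldNormedType.Exports.

Set Implicit Arguments.
Unset Strict Implicit.
Unset Printing Implicit Defensive.

Local Open Scope classical_set_scope.
Local Open Scope ring_scope.

(** * Subsums of a positive summable sequence *)

(** An order-free form of summability, stable under inserting or deleting a term; monotonicity is
    kept separate. *)
Definition pos_summable (R : realType) (x : nat -> R) : Prop :=
  positive_seq x /\ (\esum_(i in [set: nat]) (x i)%:E < +oo)%E.

Definition subsum (R : realType) (x : nat -> R) (A : set nat) : R :=
  fine (\esum_(i in A) (x i)%:E).

Definition from (n : nat) : set nat := [set i | (n <= i)%N].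

Definition tail_subsums (R : realType) (x : nat -> R) (p : nat) : set R :=
  [set s | exists2 A, A `<=` from p & s = subsum x A].

Section Subsums.
Variables (R : realType) (x : nat -> R).
Hypothesis x_ps : pos_summable x.
Implicit Types (A B : set nat).

Let x_gt0 i : 0 < x i. Proof. by case: x_ps => + _; apply. Qed.

Let x_ge0 i : (0 <= (x i)%:E)%E. Proof. by rewrite lee_fin ltW. Qed.

Lemma esum_mono A B : A `<=` B ->
  (\esum_(i in A) (x i)%:E <= \esum_(i in B) (x i)%:E)%E.
Proof.
move=> AB; rewrite [leRHS](esumID A) => [|i _]; last exact: x_ge0.
rewrite (_ : B `&` A = A); last by apply/setIidPr.
by rewrite leeDl // esum_ge0 // => i _; apply: x_ge0.
Qed.

Lemma subsumE A : (subsum x A)%:E = \esum_(i in A) (x i)%:E.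
Proof.
apply: fineK; rewrite ge0_fin_numE; last by apply: esum_ge0 => i _; apply: x_ge0.
by apply: le_lt_trans (esum_mono (@subsetT _ A)) _; case: x_ps.
Qed.

Lemma subsum_ge0 A : 0 <= subsum x A.
Proof. by rewrite -lee_fin subsumE esum_ge0. Qed.

Lemma subsum0 : subsum x set0 = 0.
Proof. by rewrite /subsum esum_set0. Qed.

Lemma subsum1 i : subsum x [set i] = x i.
Proof. by rewrite /subsum esum_set1. Qed.

Lemma subsumU A B : A `&` B = set0 -> subsum x (A `|` B) = subsum x A + subsum x B.
Proof.
move=> AB0; apply: EFin_inj; rewrite EFinD !subsumE.
rewrite (esumID A); last by move=> i _; apply: x_ge0.
congr (_ + _)%E; first by rewrite setUK.
rewrite setIUl setICr set0U; congr (esum _ _).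
apply/setIidPl => i Bi Ai; suff: set0 i by [].
by rewrite -AB0.
Qed.

Lemma subsumD A B : A `<=` B -> subsum x B = subsum x A + subsum x (B `\` A).
Proof. by move=> AB; rewrite -subsumU ?setDUK // setDIK. Qed.

Lemma subsum_mono A B : A `<=` B -> subsum x A <= subsum x B.
Proof. by move=> /subsumD ->; rewrite lerDl subsum_ge0. Qed.

Lemma subsumU_le A B : subsum x (A `|` B) <= subsum x A + subsum x B.
Proof.
rewrite (@subsumD A (A `|` B)) ?lerD2l; last exact: subsetUl.
by apply: subsum_mono => i [[]].
Qed.

Lemma subsum_mem A i : A i -> subsum x A = x i + subsum x (A `\ i).
Proof.
move=> Ai; rewrite (@subsumD [set i]) ?subsum1 //.
by move=> _ ->.
Qed.

Lemma subsum_ge A i : A i -> x i <= subsum x A.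
Proof. by move=> /subsum_mem ->; rewrite lerDl subsum_ge0. Qed.

Lemma subsum_add A i : ~ A i -> subsum x (i |` A) = x i + subsum x A.
Proof.
move=> nAi; rewrite subsumU ?subsum1 //.
by apply/seteqP; split=> j //= [-> /nAi].
Qed.

Lemma subsum_from p : subsum x (from p) = x p + subsum x (from p.+1).
Proof.
rewrite (@subsum_mem _ p); last exact: leqnn.
congr (_ + subsum _ _); apply/seteqP; split => i; rewrite /from /=; first lia.
by move=> pi; split; lia.
Qed.

(** Otherwise every finite subsum, which misses some tail, is at most the total minus [e], and so is
    their supremum, the total. *)
Lemma tail_subsum_small (e : R) : 0 < e -> exists N, subsum x (from N) < e.
Proof.
move=> e0.
apply: contrapT => /forallNP tail_ge.
suff : ((subsum x [set: nat])%:E <= (subsum x [set: nat] - e)%:E)%E.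
  by rewrite lee_fin; lra.
rewrite {1}subsumE; apply: ge_ereal_sup => _ [F [finF _] <-].
rewrite -esum_fset //.
rewrite -subsumE lee_fin.
have [N FN] : exists N, F `<=` ~` from N.
  have [t ->] := (finite_seqP _).1 finF.
  exists (\max_(i <- t) i).+1 => i /= it; rewrite /from /=.
  by apply/negP; rewrite -ltnNge ltnS; apply: (@leq_bigmax_seq _ t xpredT id).
have /negP := tail_ge N; rewrite -leNgt => eN.
by have := subsum_mono FN; rewrite (subsumD (@subsetT _ (from N))) setTD; lra.
Qed.
End Subsums.

(** For the subsums of a tail, the reflection is complementation of the index set. The maximum of
    [G] is [r]. *)
Definition symmetric_set (R : realType) (G : set R) (r : R) : Prop :=
  [/\ G 0, forall e, G e -> 0 <= e & forall e, G e -> G (r - e)].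

Lemma symmetric_set_le (R : realType) (G : set R) (r e : R) :
  symmetric_set G r -> G e -> 0 <= e <= r.
Proof.
case=> _ G_ge0 G_sym Ge; rewrite G_ge0 //= -subr_ge0.
by apply: G_ge0; apply: G_sym.
Qed.

(* The part of [E] below [a + b], where [b < a] are consecutive values of the
   sequence, [m] is the multiplicity of [b] and [G] consists of the subsums of
   the terms smaller than [b]. *)
Definition two_level (R : realType) (E G : set R) (r b a : R) (m : nat) : Prop :=
  [/\ r < b, m%:R * b + r < a,
    forall s, E s -> s < a -> exists2 j, (j <= m)%N & G (s - j%:R * b) &
    forall s, E s -> a <= s -> s < a + b -> G (s - a)].

(** * Subsums of a tail: reflection, truncation, density *)

Section Tails.
Variables (R : realType) (x : nat -> R).
Hypothesis x_ps : pos_summable x.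
Implicit Types (p : nat) (s c : R).

Local Notation T := (fun p => subsum x (from p)).

Lemma tail_subsums_tail p : tail_subsums x p (T p).
Proof. by exists (from p). Qed.

Lemma tail_subsums_bounds p s : tail_subsums x p s -> 0 <= s <= T p.
Proof. by move=> [A Ap ->]; rewrite subsum_ge0 // subsum_mono. Qed.

Lemma tail_subsums_sym p : symmetric_set (tail_subsums x p) (T p).
Proof.
split=> [|e /tail_subsums_bounds/andP[]//|_ [A Ap ->]].
  by exists set0; rewrite ?subsum0.
exists (from p `\` A); first by move=> i [].
by rewrite (subsumD x_ps Ap) addrC addKr.
Qed.

Lemma tail_subsums_le p q : (p <= q)%N -> tail_subsums x q `<=` tail_subsums x p.
Proof.
move=> pq s [A Aq ->]; exists A => // i /Aq; rewrite /from /=; lia.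
Qed.

Lemma tail_subsums_term p i : (p <= i)%N -> tail_subsums x p (x i).
Proof. by move=> pi; exists [set i]; rewrite ?subsum1 // => _ ->. Qed.

Lemma tail_subsums_add p i s : (p <= i)%N ->
  tail_subsums x i.+1 s -> tail_subsums x p (x i + s).
Proof.
move=> pi [A Ai ->]; exists (i |` A); last by rewrite subsum_add // => /Ai; rewrite /from /= ltnn.
move=> j [->|/Ai] //; rewrite /from /=; lia.
Qed.

Lemma tail_subsums_lt p q c s : (forall i, (q <= i < p)%N -> c <= x i) ->
  tail_subsums x q s -> s < c -> tail_subsums x p s.
Proof.
move=> xc [A Aq ->] lt_c; exists A => // i Ai; rewrite /from /= leqNgt; apply/negP => ip.
have := subsum_ge x_ps Ai; have := xc i; rewrite ip (Aq i Ai) => /(_ isT); lra.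
Qed.

Lemma term_small c : 0 < c -> exists N, x N < c.
Proof.
move=> /(tail_subsum_small x_ps)[N NT]; exists N; apply: le_lt_trans NT.
by apply: subsum_ge => //; rewrite /from /=.
Qed.

Lemma first_below c : nonincreasing_seq x -> 0 < c ->
  exists p, (forall i, (i < p)%N -> c <= x i) /\ (forall i, (p <= i)%N -> x i < c).
Proof.
move=> x_dec /term_small ex_p; case: (ex_minnP ex_p) => p xp p_min.
exists p; split=> i ip; last by apply: le_lt_trans xp; apply: x_dec.
by rewrite leNgt; apply/negP => /p_min; lia.
Qed.

(** Brackets [c] greedily, deciding whether to use [x p] and passing to the next tail; it shows that
    the subsums cannot jump over an interval of length [d]. *)
Lemma tail_subsums_dense p d c :
  (forall m, (p <= m)%N -> x m - T m.+1 < d) -> 0 < d -> 0 <= c < T p ->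
  exists f f', [/\ tail_subsums x p f, tail_subsums x p f', f <= c < f' & f' - f < d].
Proof.
move=> xT d0; have [N NT] := tail_subsum_small x_ps d0.
(* [k] bounds the number of terms to decide before the remaining tail sum is below [d]. *)
have [k] : exists k, (N <= p + k)%N by exists N; lia.
elim: k p c xT => [|k IH] p c xT Npk cT.
  exists 0, (T p); split; [| exact: tail_subsums_tail | by [] |].
    by case: (tail_subsums_sym p).
  have : T p <= T N by apply: subsum_mono => // i; rewrite /from /=; lia.
  by rewrite subr0; move=> /le_lt_trans; apply.
have Tp : T p = x p + T p.+1 by apply: subsum_from.
have IHp c' := IH p.+1 c' (fun m pm => xT m (ltnW pm)) ltac:(lia).
case: (ltP c (T p.+1)) => [cT1|cT1].
  have [|f [f' [Ff Ff' fcf' ff']]] := IHp c; first by rewrite cT1; case/andP: cT => ->.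
  by exists f, f'; split=> //; apply: (tail_subsums_le (leqnSn p)).
case: (leP (x p) c) => [xc|cx].
  have [|f [f' [Ff Ff' fcf' ff']]] := IHp (c - x p).
    by move: cT; rewrite Tp; lra.
  exists (x p + f), (x p + f'); split; [exact: tail_subsums_add|exact: tail_subsums_add|lra|lra].
(* Here [T p.+1 <= c < x p], and the hypothesis bounds exactly this jump. *)
exists (T p.+1), (x p); split.
- exact/(tail_subsums_le (leqnSn p))/tail_subsums_tail.
- exact: tail_subsums_term.
- by rewrite cT1.
- exact: xT.
Qed.

End Tails.

Lemma tail_eq (R : realType) (x y : nat -> R) p q :
  pos_summable x -> pos_summable y ->
  tail_subsums x p = tail_subsums y q -> subsum x (from p) = subsum y (from q).
Proof.
move=> xps yps xy; apply/eqP; rewrite eq_le.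
have := tail_subsums_tail x p; rewrite xy => /(tail_subsums_bounds yps)/andP[_ ->].
by have := tail_subsums_tail y q; rewrite -xy => /(tail_subsums_bounds xps)/andP[_ ->].
Qed.

(** * Cuts and blocks of a semi-fast sequence *)

Definition fast_blocks (R : realType) (y : nat -> R) : Prop :=
  forall n, subsum y [set i | y i < y n] < y n.

(* [0] counts as a cut. *)
Definition cut (R : realType) (y : nat -> R) (n : nat) : Prop :=
  (0 < n)%N -> y n < y n.-1.

(** For non-increasing [y] these are the maximal constant runs, so [m] is the multiplicity of the
    value [y n]. *)
Definition block (R : realType) (y : nat -> R) (n m : nat) : Prop :=
  [/\ (0 < m)%N, cut y n, forall i, (n <= i < n + m)%N -> y i = y n &
      y (n + m)%N < y n].

Lemma tail_subsums_run (R : realType) (y : nat -> R) n m (b s : R) :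
  pos_summable y -> (forall i, (n <= i < n + m)%N -> y i = b) ->
  tail_subsums y n s ->
  exists2 j, (j <= m)%N & tail_subsums y (n + m) (s - j%:R * b).
Proof.
move=> yps; elim: m n s => [|m IH] n s yb Fs.
  by exists 0%N => //; rewrite mul0r subr0 addn0.
have yb1 i : (n.+1 <= i < n.+1 + m)%N -> y i = b by move=> ?; apply: yb; lia.
have ynb : y n = b by apply: yb; lia.
case: Fs => A An ->; have [nA|nA] := pselect (A n).
  have [|j jm] := IH n.+1 (subsum y (A `\ n)) yb1.
    exists (A `\ n) => // i [/An + /eqP]; rewrite /from /=; lia.
  rewrite addSnnS (subsum_mem yps nA) ynb => Fj; exists j.+1; first by [].
  rewrite -natr1 mulrDl mul1r.
  by have -> : b + subsum y (A `\ n) - (j%:R * b + b) = subsum y (A `\ n) - j%:R * b by ring.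
have [|j jm] := IH n.+1 (subsum y A) yb1; last first.
  by rewrite addSnnS => Fj; exists j => //; apply: leq_trans jm _.
exists A => // i iA; have := An i iA; have : i <> n by move=> E; rewrite E in iA.
rewrite /from /=; lia.
Qed.

Lemma subsum_run (R : realType) (y : nat -> R) n m (b : R) :
  pos_summable y -> (forall i, (n <= i < n + m)%N -> y i = b) ->
  subsum y [set i | (n <= i < n + m)%N] = m%:R * b.
Proof.
move=> yps; elim: m => [|m IH] yb.
  rewrite mul0r (_ : [set _ | _] = set0) ?subsum0 //.
  by apply/seteqP; split => i //=; lia.
rewrite (@subsum_mem _ _ yps _ (n + m)%N) /=; last lia.
rewrite -natr1 mulrDl mul1r addrC yb; last lia.
rewrite -IH => [|i ?]; last by apply: yb; lia.
congr (subsum _ _ + _); apply/seteqP; split => i /=; first by move=> [? /eqP]; lia.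
by move=> ?; split; [lia|move=> E; move: E; lia].
Qed.

Section FastBlocks.
Variables (R : realType) (y : nat -> R).
Hypotheses (y_ps : pos_summable y) (y_dec : nonincreasing_seq y).
Hypothesis y_fast : fast_blocks y.

Local Notation T := (fun p => subsum y (from p)).

Lemma cut_gap n : (0 < n)%N -> cut y n -> T n < y n.-1.
Proof.
move=> n0 /(_ n0) yn; apply: le_lt_trans (y_fast n.-1); apply: subsum_mono => //.
by move=> i ni /=; apply: le_lt_trans yn; apply: y_dec.
Qed.

Lemma cut_above n i : cut y n -> (i < n)%N -> y n.-1 <= y i.
Proof. by move=> _ lin; apply: y_dec; lia. Qed.

Lemma below_block i : exists j, [/\ (i < j)%N, cut y j, y j.-1 = y i & y j < y i].
Proof.
have [yi_gt0 _] := y_ps; have ex_p := term_small y_ps (yi_gt0 i).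
case: (ex_minnP ex_p) => j yj j_min.
have ij : (i < j)%N.
  by rewrite ltnNge; apply/negP => /y_dec; rewrite leNgt yj.
have yj1 : y j.-1 = y i.
  apply/eqP; rewrite eq_le y_dec /=; last lia.
  by rewrite leNgt; apply/negP => /j_min; lia.
by exists j; split=> // _; rewrite yj1.
Qed.

Lemma cut_block n : cut y n -> exists m, block y n m.
Proof.
move=> yn; have [j [nj yj yj1 yjn]] := below_block n; exists (j - n)%N.
split=> //; [lia| |by rewrite subnKC // ltnW].
move=> i ij; apply/eqP; rewrite eq_le y_dec /=; last by case/andP: ij.
by rewrite -yj1 y_dec //; lia.
Qed.

Lemma block_cut n m : block y n m -> cut y (n + m) /\ y (n + m).-1 = y n.
Proof.
move=> [m0 _ yb ynm]; have yl : y (n + m).-1 = y n by apply: yb; lia.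
by split=> // _; rewrite yl.
Qed.

(** Recovers the subsums of the tail at a cut from the whole set and the value before the cut, which
    allows a comparison with [x]. *)
Lemma tail_subsums_cut n s : (0 < n)%N -> cut y n ->
  tail_subsums y n s <-> tail_subsums y 0 s /\ s < y n.-1.
Proof.
move=> n0 yn; split=> [Fs|[Es sy]].
  split; first exact: tail_subsums_le Fs.
  by apply: le_lt_trans (cut_gap n0 yn); case/andP: (tail_subsums_bounds y_ps Fs).
by apply: (tail_subsums_lt y_ps _ Es sy) => i /andP[_]; apply: cut_above.
Qed.

Lemma block_tail n m : block y n m -> T n = m%:R * y n + T (n + m)%N.
Proof.
case=> _ _ ybn _; rewrite -(subsum_run y_ps ybn) -subsumU //; last first.
  by apply/seteqP; split=> i //= [/=]; rewrite /from /=; lia.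
by congr subsum; apply/seteqP; split=> i /=; rewrite /from /=; [move=> ?|case=> ?]; lia.
Qed.

Lemma block_two_level n m : (0 < n)%N -> block y n m ->
  two_level (tail_subsums y 0) (tail_subsums y (n + m)) (T (n + m)%N) (y n) (y n.-1) m.
Proof.
move=> n0 yb; have [m0 yn ybn ynm] := yb; have [ycut yl] := block_cut yb.
have Tnm : T (n + m)%N < y n by rewrite -yl; apply: cut_gap => //; lia.
have Tn := cut_gap n0 yn.
split=> // [|s Es sy|s [A _ ->] sge slt]; first by rewrite -block_tail.
  by apply: tail_subsums_run => //; apply/tail_subsums_cut.
(* Without an index below [n] the sum would be at most [T n < y n.-1]. *)
have [i [Ai iln]] : exists i, A i /\ (i < n)%N.
  apply: contrapT => /forallNP nA; suff : subsum y A <= T n by move: Tn sge; lra.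
  apply: subsum_mono => // i Ai; rewrite /from /= leqNgt; apply/negP => iln.
  by apply: (nA i).
(* If [y i] were larger, the terms below it would include [y n.-1] and [y n], forcing
   [y i > y n.-1 + y n > s]. *)
have yi : y i = y n.-1.
  have := subsum_ge y_ps Ai; have := cut_above yn iln.
  rewrite le_eqVlt => /predU1P[-> //|gt_yi le_yi].
  have := y_fast i; suff : y n.-1 + y n <= subsum y [set j | y j < y i] by move: le_yi slt; lra.
  rewrite (@subsum_mem _ _ y_ps _ n.-1) //; rewrite lerD2l; apply: subsum_ge => //.
  split=> /=; first by apply: lt_trans gt_yi; apply: yn.
  by move/eqP; lia.
exists (A `\ i); last by rewrite (subsum_mem y_ps Ai) yi addrC addKr.
have slt' : subsum y (A `\ i) < y n by move: slt; rewrite (subsum_mem y_ps Ai) yi; lra.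
move=> k Ak; rewrite /from /= leqNgt; apply/negP => kl.
have := subsum_ge y_ps Ak; suff : y n <= y k by move: slt'; lra.
by rewrite -yl; apply: y_dec; lia.
Qed.

End FastBlocks.

(** * Uniqueness for irreducible sequences *)

Section TwoLevel.
Variables (R : realType) (E G : set R) (r b a : R) (m : nat).

Lemma two_level_le s : symmetric_set G r -> two_level E G r b a m ->
  E s -> s < a -> s <= m%:R * b + r.
Proof.
move=> Gsym [rb _ low _] Es /(low s Es)[j jm /(symmetric_set_le Gsym)].
have [/(symmetric_set_le Gsym)/andP[_ r0] _ _] := Gsym.
suff : j%:R * b <= m%:R * b by lra.
by rewrite ler_wpM2r ?ler_nat //; lra.
Qed.

(** Applied when large terms of [x] have subsums [m b + h] and [(m + 1) b + h], one [b] more than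
    the run in [y] allows. Depending on the sign of [a - (m + 1) b], [e] is chosen so that a sum
    falls into a gap. *)
Lemma no_overlong_run h : symmetric_set G r -> two_level E G r b a m ->
  a <> m.+1%:R * b -> G h ->
  (forall e, G e -> E (m%:R * b + h + e)) ->
  (forall e, G e -> E (m.+1%:R * b + h + e)) -> False.
Proof.
move=> Gsym EG a_irr Gh Em Em1; have [G0 _ Gopp] := Gsym.
have [rb ba low mid] := EG.
have hr := symmetric_set_le Gsym Gh.
have le_E s := @two_level_le s Gsym EG.
have mE : m.+1%:R * b = m%:R * b + b by rewrite mulrSr mulrDl mul1r.
move: a_irr Em1; rewrite mE; set mb := m%:R * b in ba mE Em le_E *.
move=> anb Em1; case: (ltrgtP a (mb + b)) => [alt|agt|//].
  (* [(m + 1) b + r] lies in the gap between [a + r] and [a + b]. *)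
  have := Em1 _ (Gopp _ Gh) => /mid H.
  have /(symmetric_set_le Gsym) : G (mb + b + h + (r - h) - a) by apply: H; lra.
  by lra.
(* With [f = a - (m + 1) b], [m b + r + f] lies in the gap below [a]. *)
have E1 := Em1 _ G0; case: (ltP (mb + b + h + 0) a) => [slt|sge].
  by have := le_E _ E1 slt; lra.
have /Gopp /Em E2 : G (mb + b + h + 0 - a) by apply: mid => //; lra.
by have := le_E _ E2 ltac:(lra); lra.
Qed.

(** Excludes that [x] obtains [2 b] as a term [b + h] plus small terms of sum [e], next to another
    term [b]. *)
Lemma no_split_double h e : symmetric_set G r -> two_level E G r b a 2 ->
  a <> 3%:R * b -> G h -> G e -> h + e = b ->
  (forall e, G e -> E (b + h + e)) ->
  (forall e, G e -> E (2%:R * b + h + e)) -> False.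
Proof.
move=> Gsym EG a_irr Gh Ge heb E1 E2; have [G0 _ Gopp] := Gsym.
have [rb ba low mid] := EG.
have hr := symmetric_set_le Gsym Gh; have er := symmetric_set_le Gsym Ge.
(* If [3 b < a], then [2 b + h + e = 3 b] is an element of [E] below [a] but beyond [2 b + r]. *)
have alt : a < 3%:R * b.
  rewrite lt_neqAle; apply/andP; split; first exact/eqP.
  rewrite leNgt; apply/negP => lta.
  have [|[|[|[|//]]] _ /(symmetric_set_le Gsym)] := low _ (E2 _ Ge); lra.
have Gr : G r by rewrite -(subr0 r); apply: Gopp.
(* Since [e <= r < b], [h] is positive; so [2 b + h + r] exceeds [2 b + r] and cannot lie below
   [a]. *)
have sa : a <= 2%:R * b + h + r.
  rewrite leNgt; apply/negP => lta.
  have [|[|[|[|//]]] _ /(symmetric_set_le Gsym)] := low _ (E2 _ Gr); lra.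
(* [a - b] lies in the gap between [b + r] and [2 b]. *)
have /Gopp Gg : G (2%:R * b + h + r - a) by apply: mid; [exact: E2|lra|lra].
have [|[|[|[|//]]] _ /(symmetric_set_le Gsym)] := low _ (E1 _ Gg); lra.
Qed.

End TwoLevel.

Lemma one_or_two j : (0 < j <= 2)%N -> j = 1%N \/ j = 2.
Proof. by lia. Qed.

(** * Comparison of two sequences with the same subsums *)

Section Uniqueness.
Variables (R : realType) (x y : nat -> R).
Hypotheses (x_ps : pos_summable x) (y_ps : pos_summable y).
Hypotheses (x_dec : nonincreasing_seq x) (y_dec : nonincreasing_seq y).
Hypothesis y_fast : fast_blocks y.
Hypothesis xyE : tail_subsums x 0 = tail_subsums y 0.

(** The number [p] of large terms of [x] may a priori differ from [n]; equality is derived only in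
    [unique_of_irreducible]. *)
Definition matched_cut (n : nat) : Prop :=
  exists p, (forall i, (i < p)%N -> y n.-1 <= x i) /\
    tail_subsums x p = tail_subsums y n.

Local Notation T := (fun p => subsum y (from p)).

Let y_gt0 i : 0 < y i. Proof. by case: y_ps => + _; apply. Qed.

(** Both sets of tail subsums are then the part of the common set below [y n.-1], so matching
    reduces to a bound on one tail sum of [x]. *)
Lemma matched_cut_of_lt n p : (0 < n)%N -> cut y n ->
  (forall i, (i < p)%N -> y n.-1 <= x i) -> subsum x (from p) < y n.-1 ->
  matched_cut n.
Proof.
move=> n0 yn xp Tx; exists p; split => //; apply/seteqP; split=> s Fs.
  apply/tail_subsums_cut => //; split.
    by rewrite -xyE; apply: tail_subsums_le Fs.
  by apply: le_lt_trans Tx; case/andP: (tail_subsums_bounds x_ps Fs).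
have [Es lts] := (tail_subsums_cut y_ps y_dec y_fast s n0 yn).1 Fs.
move: Es; rewrite -xyE => Es.
by apply: (tail_subsums_lt x_ps _ Es lts) => i /andP[_]; apply: xp.
Qed.

(* Remove a small term of [z] if there is one; otherwise replace the last term
   [y_i] of [z] by all terms smaller than [y_i]. *)
Lemma subsum_predecessor n z d :
  (forall j, (n < j)%N -> cut y j -> y j.-1 - T j < d) -> 0 < d ->
  tail_subsums y n z -> 0 < z ->
  exists e, [/\ tail_subsums y 0 e, e < z & z - e < d].
Proof.
move=> gapd d0 [A An ->] A_gt0.
have [[i [Ai yi]]|nsmall] := pselect (exists i, A i /\ y i < d).
  exists (subsum y (A `\ i)); split; first by exists (A `\ i).
    by rewrite (subsum_mem y_ps Ai) ltrDr y_gt0.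
  by rewrite (subsum_mem y_ps Ai) addrK.
(* No term indexed by [A] is below [d], so [A] is finite and has a largest index [i]. *)
have [N yN] := term_small y_ps d0.
have exA : exists i, `[< A i >].
  apply: contrapT => /forallNP nA; move: A_gt0; rewrite (_ : A = set0).
    by rewrite subsum0 ltxx.
  by apply/seteqP; split => i // Ai; apply: (nA i); apply/asboolP.
have boundA i : `[< A i >] -> (i <= N)%N.
  move=> /asboolP Ai; rewrite leqNgt; apply/negP => Ni; apply: nsmall.
  by exists i; split=> //; apply: le_lt_trans yN; apply: y_dec; apply: ltnW.
case: (ex_maxnP exA boundA) => i /asboolP Ai i_max.
have [j [ij yj yj1 yji]] := below_block y_ps y_dec i.
have Tj : T j < y i by rewrite -yj1; apply: cut_gap => //; lia.
have ni : (n <= i)%N := An i Ai.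
have := gapd j ltac:(lia) yj; rewrite yj1 => gapj.
have disj : (A `\ i) `&` from j = set0.
  apply/seteqP; split=> k // [[Ak _]]; rewrite /from /=.
  by have := i_max k ltac:(by apply/asboolP); lia.
(* The sum drops by [y i - T j], the length of a gap at a cut after [n]. *)
exists (subsum y ((A `\ i) `|` from j)); rewrite subsumU // (subsum_mem y_ps Ai).
split; [by exists ((A `\ i) `|` from j); rewrite ?subsumU|lra|lra].
Qed.

Lemma dominating_gap_matched n : (0 < n)%N -> cut y n ->
  (forall j, (n < j)%N -> cut y j -> y j.-1 - T j < y n.-1 - T n) ->
  matched_cut n.
Proof.
move=> n0 yn gap_lt; have Tn := cut_gap y_ps y_dec y_fast n0 yn.
have [p [xge xlt]] := first_below x_ps x_dec (y_gt0 n.-1).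
apply: (matched_cut_of_lt n0 yn xge); apply: le_lt_trans Tn.
rewrite leNgt; apply/negP => Tp.
have T0 : 0 <= T n by apply: subsum_ge0.
have d0 : 0 < y n.-1 - T n by have := cut_gap y_ps y_dec y_fast n0 yn; lra.
have below s : tail_subsums x 0 s -> s < y n.-1 -> s <= T n.
  rewrite xyE => Es lts.
  have /(tail_subsums_cut y_ps y_dec y_fast s n0 yn) Fs := conj Es lts.
  by case/andP: (tail_subsums_bounds y_ps Fs).
(* The predecessor [e] of [x m] in the common set uses only terms after index [m], so the tail sum
   after [m] is at least [e > x m - d]. *)
have dense m : (p <= m)%N -> x m - subsum x (from m.+1) < y n.-1 - T n.
  move=> pm; have xm0 : 0 < x m by case: x_ps => + _; apply.
  have Ex : tail_subsums y 0 (x m) by rewrite -xyE; apply: tail_subsums_term.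
  have /(tail_subsums_cut y_ps y_dec y_fast (x m) n0 yn) Fx := conj Ex (xlt m pm).
  have [e [+ em xme]] := subsum_predecessor gap_lt d0 Fx xm0.
  rewrite -xyE => Ee.
  have : tail_subsums x m.+1 e.
    by apply: (tail_subsums_lt x_ps _ Ee em) => i /andP[_ im]; apply: x_dec.
  by move=> /(tail_subsums_bounds x_ps)/andP[_]; lra.
(* The pair brackets [T n] more tightly than the gap, so [f'] falls inside it. *)
have [|f [f' [Ff Ff' fT ff']]] := tail_subsums_dense x_ps (c := T n) dense d0.
  by rewrite T0.
case: (ltP f' (y n.-1)) => f'y; last by lra.
by have := below _ (tail_subsums_le (leq0n p) Ff') f'y; lra.
Qed.

(** Gaps are bounded by the terms, which tend to 0; so there is a last cut after [N] whose gap is at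
    least that of a fixed cut [n1]. *)
Lemma dominating_gap_exists N : exists n, [/\ (N < n)%N, cut y n &
  forall j, (n < j)%N -> cut y j -> y j.-1 - T j < y n.-1 - T n].
Proof.
have [n1 [Nn1 yn1 _ _]] := below_block y_ps y_dec N.
have Tn1 := cut_gap y_ps y_dec y_fast (leq_ltn_trans (leq0n N) Nn1) yn1.
pose g j := y j.-1 - T j.
have g0 : 0 < g n1 by rewrite subr_gt0.
have [K yK] := term_small y_ps g0.
pose P j := `[< [/\ (N < j)%N, cut y j & g n1 <= g j] >].
have exP : exists j, P j by exists n1; apply/asboolP.
have boundP j : P j -> (j <= K)%N.
  move=> /asboolP[_ _ gj]; rewrite leqNgt; apply/negP => Kj.
  have : y j.-1 <= y K by apply: y_dec; lia.
  have : 0 <= T j by apply: subsum_ge0.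
  by move: gj yK; rewrite /g; lra.
case: (ex_maxnP exP boundP) => n /asboolP[Nn yn gn] n_max.
exists n; split=> // j nj yj; rewrite -/(g j) -/(g n); apply: lt_le_trans gn.
rewrite ltNge; apply/negP => gj; have /n_max : P j by apply/asboolP; split=> //; lia.
by lia.
Qed.

Lemma matched_cut_step n m : (0 < n)%N -> block y n m -> (m <= 2)%N ->
  y n.-1 <> m.+1%:R * y n -> matched_cut (n + m) -> matched_cut n.
Proof.
move=> n0 yb m2 irr [p' [xp' Fxy]]; have [m0 yn ybn _] := yb.
have [ycut yl] := block_cut yb.
have two := block_two_level y_ps y_dec y_fast n0 yb.
have := tail_subsums_sym y_ps (n + m); have [rb ba low _] := two.
(* From here on [E] and [G] are sets of subsums of [x], so the two-level structure of [y] constrains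
   [x]. *)
rewrite -Fxy -xyE in two low *.
set a := y n.-1 in irr two low ba *; set b := y n in irr two low rb ba *.
set r := T _ in two low rb ba *; set G := tail_subsums x p' in two low *.
move=> Gsym; have Gle e := @symmetric_set_le _ G r e Gsym.
have G0 : G 0 by case: Gsym.
have Tp' : subsum x (from p') = r by apply: tail_eq.
have r0 : 0 <= r by apply: subsum_ge0.
rewrite yl -/b in xp'.
have [p [xge xlt]] := first_below x_ps x_dec (y_gt0 n.-1).
rewrite -/a in xge xlt.
apply: (matched_cut_of_lt n0 yn xge); rewrite -/a ltNge; apply/negP => aT.
have Ex i : tail_subsums x 0 (x i) by apply: tail_subsums_term.
have addE A e : A `<=` [set i | (i < p')%N] -> G e -> tail_subsums x 0 (subsum x A + e).
  move=> Ap' [B Bp' ->]; exists (A `|` B) => //; rewrite subsumU //.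
  by apply/seteqP; split=> i //= [/Ap' + /Bp']; rewrite /from /=; lia.
have add1E i e : (i < p')%N -> G e -> tail_subsums x 0 (x i + e).
  by move=> ip'; rewrite -(subsum1 x_ps); apply: addE => _ ->.
have sub2 i j : i <> j -> subsum x [set i; j] = x i + x j.
  by move=> ij; rewrite subsum_add ?subsum1.
have add2E i j e : (i < p')%N -> (j < p')%N -> i <> j -> G e ->
    tail_subsums x 0 (x i + x j + e).
  by move=> ip' jp' ij; rewrite -sub2 //; apply: addE => _ [|] ->.
have add3E i j k e : (i < p')%N -> (j < p')%N -> (k < p')%N ->
    i <> j -> i <> k -> j <> k -> G e -> tail_subsums x 0 (x i + x j + x k + e).
  move=> ip' jp' kp' ij ik jk.
  have -> : x i + x j + x k = subsum x (k |` [set i; j]).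
    have nk : ~ [set i; j] k by move=> [/= E|/= E]; [apply: ik|apply: jk].
    by rewrite (subsum_add x_ps nk) (sub2 i j ij) addrC.
  by apply: addE => _ [->|[|] ->].
(* The terms of [x] with index in [[p, p')] are the ones in [[b, a)]; [j = 0] is impossible because
   [G] stays at or below [r < b]. *)
have decomp i : (p <= i < p')%N ->
    exists h j, [/\ (0 < j <= m)%N, G h & x i = j%:R * b + h].
  move=> /andP[pi ip']; have [[|j] jm Gj] := low _ (Ex i) (xlt i pi).
    by move: Gj (xp' i ip') => /Gle; lra.
  by exists (x i - j.+1%:R * b), j.+1; split => //; ring.
have big_index A s : A `<=` from p -> s = subsum x A -> r < s ->
    exists i, [/\ A i, (p <= i < p')%N & x i + subsum x (A `\ i) = s].
  move=> Ap -> rs; have [i [Ai ip']] : exists i, A i /\ (i < p')%N.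
    apply: contrapT => /forallNP nA; suff : subsum x A <= subsum x (from p').
      by rewrite Tp'; lra.
    apply: subsum_mono => // i Ai; rewrite /from /= leqNgt; apply/negP => ip'.
    by apply: (nA i).
  by exists i; split; rewrite ?(subsum_mem x_ps Ai) // ip' (Ap i Ai).
have inF s : tail_subsums y 0 s -> s < a ->
    exists2 A, A `<=` from p & s = subsum x A.
  rewrite -xyE => Es lts.
  by apply: (tail_subsums_lt x_ps _ Es lts) => i /andP[_]; apply: xge.
(* As [b > r], a representation of [b] in [x] uses a term at least [b], which must then equal
   [b]. *)
have [A Ap bA] : exists2 A, A `<=` from p & b = subsum x A.
  apply: inF; first by apply: tail_subsums_term.
  have : 1 * b <= m%:R * b by rewrite ler_pM2r ?y_gt0 // ler1n.
  by lra.
have [i0 [_ /andP[pi0 i0p'] xi0]] := big_index _ _ Ap bA rb.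
have {xi0 A Ap bA} xi0 : x i0 = b.
  by have := xp' i0 i0p'; have := subsum_ge0 x_ps (A `\ i0); lra.
(* The assumed tail sum is at least [a > m b + r], so indices of total at most [m b] do not exhaust
   [[p, p')]. *)
have more A : subsum x A <= m%:R * b -> exists i, (p <= i < p')%N /\ ~ A i.
  move=> sA; apply: contrapT => /forallNP nA.
  suff : subsum x (from p) <= subsum x A + r by lra.
  rewrite -Tp'; apply: le_trans (subsumU_le x_ps _ _); apply: subsum_mono => // i pi.
  have [Ai|nAi] := pselect (A i); first by left.
  right; rewrite /from /= leqNgt; apply/negP => ip'; apply: (nA i).
  by split=> //; rewrite ip' andbT.
have [m1|{}m2] : m = 1%N \/ m = 2 by apply: one_or_two; rewrite m0.
  have [|i1 [/andP[pi1 i1p'] ni]] := more [set i0].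
    by rewrite subsum1 // m1 xi0 mul1r.
  have [|h [j [j1 Gh xi1]]] := decomp i1; first by rewrite pi1.
  have j1E : j = 1%N by lia.
  rewrite j1E in xi1.
  apply: (no_overlong_run Gsym two irr Gh) => e Ge; rewrite m1.
    by rewrite -xi1; apply: add1E.
  suff -> : 2%:R * b + h + e = x i0 + x i1 + e by apply: add2E => // /esym.
  by rewrite xi1 xi0; ring.
rewrite m2 in ba irr two low decomp more.
(* For [m = 2] the cases depend on how [x] represents [2 b]: as [b + h] plus small terms, as
   [b + b], or as a single term. *)
have [B Bp bB] : exists2 A, A `<=` from p & 2%:R * b = subsum x A.
  apply: inF; last by lra.
  have -> : 2%:R * b = y n + y n.+1 by rewrite (ybn n.+1) ?m2 -/b; [ring|lia].
  by apply: tail_subsums_add => //; apply: tail_subsums_term.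
have [i1 [Bi1 /andP[pi1 i1p'] xi1]] := big_index _ _ Bp bB ltac:(lra).
have [|h [j [j12 Gh xi1E]]] := decomp i1; first by rewrite pi1.
have sub0 := subsum_ge0 x_ps (B `\ i1); have hr := Gle _ Gh.
have b0 : 0 < b by apply: y_gt0.
have [j1E|j2E] := one_or_two j12.
  rewrite {}j1E in xi1E.
  case: (leP (subsum x (B `\ i1)) r) => [rest_small|rest_big].
    have Ge : G (subsum x (B `\ i1)).
      apply: (@tail_subsums_lt _ _ x_ps p' p b); last by lra.
        by move=> i /andP[_]; apply: xp'.
      by exists (B `\ i1) => // i [/Bp].
    have i01 : i0 <> i1 by move=> E; move: xi0 xi1; rewrite E; lra.
    apply: (no_split_double Gsym two irr Gh Ge); first by lra.
      by move=> e Ge'; have := add1E i1 e i1p' Ge'; rewrite xi1E mul1r.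
    move=> e Ge'; have := add2E i0 i1 e i0p' i1p' i01 Ge'; rewrite xi1E xi0.
    by congr tail_subsums; ring.
  (* Two terms at least [b] with sum at most [2 b] both equal [b]; a third large term then makes the
     run too long. *)
  have [|i2 [[_ i12] /andP[pi2 i2p'] xi2]] := big_index (B `\ i1) _ _ erefl rest_big.
    by move=> i [/Bp].
  have sub2' := subsum_ge0 x_ps ((B `\ i1) `\ i2).
  have := xp' _ i2p' => bi2; have bi1 := xp' _ i1p'.
  have xi1b : x i1 = b by lra.
  have {}xi2 : x i2 = b by lra.
  have {}xi1 := xi1b.
  have n12 : i1 <> i2 by move=> E; apply: i12.
  have [|i3 [/andP[pi3 i3p'] n3]] := more [set i1; i2].
    by rewrite sub2 // xi1 xi2; lra.
  have n13 : i1 <> i3 by move=> E; apply: n3; left.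
  have n23 : i2 <> i3 by move=> E; apply: n3; right.
  have [|h3 [j3 [j312 Gh3 xi3]]] := decomp i3; first by rewrite pi3.
  have j3E := one_or_two j312.
  apply: (no_overlong_run Gsym two irr Gh3) => e Ge; case: j3E => j3E.
  - have := add2E i1 i3 e i1p' i3p' n13 Ge; rewrite xi1 xi3 j3E.
    by congr tail_subsums; ring.
  - by have := add1E i3 e i3p' Ge; rewrite xi3 j3E.
  - have := add3E i1 i2 i3 e i1p' i2p' i3p' n12 n13 n23 Ge; rewrite xi1 xi2 xi3 j3E.
    by congr tail_subsums; ring.
  - have := add2E i1 i3 e i1p' i3p' n13 Ge; rewrite xi1 xi3 j3E.
    by congr tail_subsums; ring.
(* Now [x i1 = 2 b], and together with [x i0 = b] it reaches [3 b]. *)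
rewrite {}j2E in xi1E; have h0 : 0 <= h by case: Gsym => _ + _; apply.
have {}h0 : h = 0 by lra.
have i01 : i0 <> i1 by move=> E; move: xi0 xi1E; rewrite E; lra.
apply: (no_overlong_run Gsym two irr Gh) => e Ge.
  by have := add1E i1 e i1p' Ge; rewrite xi1E.
have := add2E i0 i1 e i0p' i1p' i01 Ge; rewrite xi0 xi1E.
by congr tail_subsums; ring.
Qed.

Lemma unique_of_irreducible :
  (forall n m, block y n m -> (m <= 2)%N /\ ((0 < n)%N -> y n.-1 <> m.+1%:R * y n)) ->
  x = y.
Proof.
move=> irr.
have matched n : (0 < n)%N -> cut y n -> matched_cut n.
  (* Descent from a dominating cut [N] beyond [n], by induction on a bound for the distance. *)
  have [N [nN yN dom]] := dominating_gap_exists n.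
  have {dom} matchedN := dominating_gap_matched (leq_ltn_trans (leq0n n) nN) yN dom.
  have [k] : exists k, (N <= n + k)%N by exists N; lia.
  have {nN} : (n <= N)%N by apply: ltnW.
  elim/ltn_ind: k n => k IH n nN Nk n0 yn.
  have [->//|nN'] := eqVneq n N.
  have [m yb] := cut_block y_ps y_dec yn; have [m2 irrn] := irr n m yb.
  have [m0 _ ybn _] := yb; have [ycut _] := block_cut yb.
  apply: (matched_cut_step n0 yb m2 (irrn n0)).
  (* A cut cannot lie strictly inside a block. *)
  have nmN : (n + m <= N)%N.
    rewrite leqNgt; apply/negP => Nnm; have := yN ltac:(lia).
    by rewrite !ybn ?ltxx //; lia.
  by apply: (IH (k - m)%N) => //; lia.
pose agree n := (forall i, (i < n)%N -> x i = y i) /\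
    tail_subsums x n = tail_subsums y n.
suff agree_far N : exists n, [/\ (N <= n)%N, cut y n & agree n].
  by apply/funext => i; have [n [iln _ [xy _]]] := agree_far i.+1; apply: xy.
elim: N => [|N [n [Nn yn [xyn Fn]]]]; first by exists 0%N.
have [m yb] := cut_block y_ps y_dec yn; have [m2 _] := irr n m yb.
have [m0 _ ybn _] := yb; have [ycut yl] := block_cut yb.
have nm0 : (0 < n + m)%N by lia.
exists (n + m)%N; split=> //; first by lia.
(* The terms of [x] from [n] to [p - 1] are at least [b] and sum to [m b]. It remains to show
   [p = n + m], after which they all equal [b]. *)
have [p [xge Fp]] := matched _ nm0 ycut.
have Tnm := cut_gap y_ps y_dec y_fast nm0 ycut.
rewrite yl in xge Tnm.
have Tn := block_tail y_ps yb; have b0 := y_gt0 n.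
have := tail_eq x_ps y_ps Fn; have := tail_eq x_ps y_ps Fp.
rewrite Tn; set r := T _ in Tnm *; set b := y n in Tnm b0 xge ybn * => Txp Txn.
have bm : 1 * b <= m%:R * b by rewrite ler_pM2r // ler1n.
have np : (n < p)%N.
  rewrite ltnNge; apply/negP => pn.
  suff : subsum x (from n) <= subsum x (from p) by lra.
  by apply: subsum_mono => // i; rewrite /from /=; lia.
have r_le q : (q <= p)%N -> r <= subsum x (from q).
  by move=> qp; rewrite -Txp; apply: subsum_mono => // i; rewrite /from /=; lia.
have xn1 := subsum_from x_ps n; have xn2 := subsum_from x_ps n.+1.
have xn3 := subsum_from x_ps n.+2.
have xnb := xge n np.
have [m1|{}m2] : m = 1%N \/ m = 2 by apply: one_or_two; rewrite m0.
  have pn1 : p = n.+1.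
    apply/eqP; rewrite eqn_leq np andbT leqNgt; apply/negP => n1p.
    by have := r_le _ n1p; have := xge _ n1p; move: Txn; rewrite m1; lra.
  rewrite m1 addn1; split; last by rewrite -[in LHS]pn1 Fp m1 addn1.
  move=> i; rewrite ltnS leq_eqVlt => /predU1P[->|/xyn//].
  by move: Txn; rewrite m1 xn1 -pn1 Txp -/b; lra.
rewrite m2 in Txn ybn.
(* If [p = n + 1], then [x n = 2 b], so [b] would be a subsum of the later terms, of total
   [r < b]. *)
have [pn1|np1] := eqVneq p n.+1.
  have : tail_subsums x n b by rewrite Fn; apply: (tail_subsums_term y_ps (leqnn n)).
  move=> Fb; suff : b <= r by lra.
  have : tail_subsums x p b.
    apply: (@tail_subsums_lt _ _ x_ps p n (2%:R * b) b _ Fb); last by lra.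
    move=> i inp; have -> : i = n by lia.
    by move: Txn; rewrite xn1 -pn1 Txp; lra.
  by rewrite Fp => /(tail_subsums_bounds y_ps)/andP[].
have n1p : (n.+1 < p)%N by lia.
have xn1b := xge _ n1p; have r2 := r_le _ n1p.
have pn2 : p = n.+2.
  apply/eqP; rewrite eqn_leq n1p andbT leqNgt; apply/negP => n2p.
  by have := r_le _ n2p; have := xge _ n2p; lra.
rewrite m2 addn2; split; last by rewrite -[in LHS]pn2 Fp m2 addn2.
move=> i; rewrite ltnS leq_eqVlt => /predU1P[->|].
  by rewrite ybn; [lra|lia].
by rewrite ltnS leq_eqVlt => /predU1P[->|/xyn//]; rewrite -/b; lra.
Qed.

End Uniqueness.

(** * Values and multiplicities *)

Lemma eq_achievement_set (R : realType) (x : nat -> R) :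
  pos_summable x -> achievement_set x = tail_subsums x 0.
Proof.
move=> x_ps; apply/seteqP; split=> [s [A]|_ [A _ ->]]; last by exists A; rewrite subsumE.
by rewrite -subsumE // => -[->]; exists A.
Qed.

Lemma summable_positive_nonincP (R : realType) (x : nat -> R) :
  summable_positive_noninc x <-> pos_summable x /\ nonincreasing_seq x.
Proof.
split=> [[x_gt0 x_dec x_cvg]|[[x_gt0 x_fin] x_dec]].
  split=> //; split=> //; rewrite -nneseries_esumT; last by move=> i; rewrite lee_fin ltW.
  have -> : (fun n => \sum_(0 <= i < n) (x i)%:E)%E = EFin \o series x.
    by apply/funext => n; rewrite /= -sumEFin.
  by rewrite EFin_lim // ltry.
split=> //; have := @summable_cvg R xpredT (fun i => (x i)%:E).
apply=> [i _|]; first by rewrite lee_fin ltW.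
have -> : (fun i => is_true (xpredT i)) = [set: nat] by apply/seteqP.
rewrite /summable; under eq_esum do rewrite abse_EFin ger0_norm ?ltW //.
by [].
Qed.

(** The terms below [y 0] have finite sum by the semi-fast condition, and convergence to 0 leaves
    finitely many others. *)
Lemma semi_fastP (R : realType) (y : nat -> R) : semi_fast y ->
  [/\ pos_summable y, nonincreasing_seq y & fast_blocks y].
Proof.
move=> [y_gt0 y_dec y_cvg0 y_fast].
have y_ge0 i : (0 <= (y i)%:E)%E by rewrite lee_fin ltW.
have y_ps : pos_summable y.
  split=> //; have [N yN] : exists N, forall i, (N <= i)%N -> y i < y 0%N.
    have /cvgrPdist_lt /(_ _ (y_gt0 0%N)) [N _ NP] := y_cvg0.
    by exists N => i /NP /=; rewrite sub0r normrN gtr0_norm.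
  rewrite (esumID [set i | y i < y 0%N]) // !setTI.
  apply: lte_add_pinfty; first by apply: lt_trans (y_fast 0%N) (ltry _).
  have fin : finite_set (~` [set i | y i < y 0%N]).
    apply: (@sub_finite_set _ _ `I_N); last exact: finite_II.
    by move=> i /= /negP yi; rewrite ltnNge; apply/negP => /yN; apply/negP.
  rewrite esum_fset // fsbig_finite //= sumEFin; exact: ltry.
split=> // n; rewrite -lte_fin subsumE //.
Qed.

Section Values.
Variables (R : realType) (y alpha : nat -> R) (M : nat -> nat).
Hypotheses (y_dec : nonincreasing_seq y) (yaM : values_multiplicities y alpha M).

Lemma block_multiplicity n m p : block y n m -> y n = alpha p -> M p = m.
Proof.
move=> [m0 yn ybn ynm] ynp; have [_ _ /(_ p) card_p] := yaM.
apply/card_eq_II; rewrite card_eq_sym in card_p; apply: card_eq_trans card_p _.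
suff -> : [set i | y i = alpha p] = `I_(n + m) `\` `I_n.
  by have := @card_IID (n + m) n; rewrite addKn.
rewrite -ynp; apply/seteqP; split=> i /=.
  move=> yin; split; last first.
    move=> lin; have n0 : (0 < n)%N by lia.
    have := yn n0; have : y n.-1 <= y i by apply: y_dec; lia.
    by rewrite yin; lra.
  rewrite ltnNge; apply/negP => /y_dec; rewrite yin; lra.
by move=> [? ?]; apply: ybn; lia.
Qed.

Lemma cut_value n : cut y n -> exists2 p, y n = alpha p &
  (0 < n)%N -> (0 < p)%N /\ y n.-1 = alpha p.-1.
Proof.
move=> yn; have [a_dec a_range _] := yaM.
have value i : exists p, y i = alpha p.
  have [p _ ap] : range alpha (y i) by rewrite a_range; exists i.
  by exists p.
have [p ynp] := value n; exists p => // n0; have [q ynq] := value n.-1.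
have := yn n0; rewrite ynp ynq => apq.
have qp : (q < p)%N.
  by rewrite ltnNge -(a_dec p q) leNgt apq.
have p0 : (0 < p)%N by lia.
split=> //; apply/eqP; rewrite eq_le; apply/andP; split; last by rewrite a_dec; lia.
(* No value is skipped: an index [i] with value [alpha p.-1 > y n] precedes [n]. *)
have [i _ yip] : range y (alpha p.-1) by rewrite -a_range; exists p.-1.
rewrite -yip -ynq; apply: y_dec.
suff : (i < n)%N by lia.
rewrite ltnNge; apply/negP => /y_dec; rewrite yip ynp leNgt => /negP; apply.
by rewrite ltNge a_dec; lia.
Qed.

Lemma value_cut p : exists2 n, cut y n & y n = alpha p.
Proof.
have [_ a_range _] := yaM.
have [i _ yi] : range y (alpha p) by rewrite -a_range; exists p.
have ex_n : exists n, y n == alpha p by exists i; rewrite yi.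
case: (ex_minnP ex_n) => n /eqP ynp n_min; exists n => // n0.
rewrite lt_neqAle (y_dec (leq_pred n)) andbT; apply/eqP => E.
by have := n_min n.-1; rewrite -E ynp eqxx => /(_ isT); lia.
Qed.

End Values.

(** Puts the condition on values and multiplicities into the block form that both directions use. *)
Lemma irreducible_blocksP (R : realType) (y alpha : nat -> R) (M : nat -> nat) :
  semi_fast y -> values_multiplicities y alpha M ->
  irreducible_seq alpha M /\ (forall n, (M n <= 2)%N) <->
  (forall n m, block y n m ->
     (m <= 2)%N /\ ((0 < n)%N -> y n.-1 <> m.+1%:R * y n)).
Proof.
move=> /semi_fastP[y_ps y_dec _] yaM; split=> [[irr M2] n m yb|irr].
  have [_ yn _ _] := yb; have [p ynp yn1] := cut_value y_dec yaM yn.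
  have <- := block_multiplicity y_dec yaM yb ynp; split=> // n0.
  have [p0 ->] := yn1 n0; rewrite ynp; have := irr p.-1; by rewrite prednK.
have value_block p : exists n m, block y n m /\ y n = alpha p.
  have [n yn ynp] := value_cut y_dec yaM p.
  by have [m yb] := cut_block y_ps y_dec yn; exists n, m.
split=> p.
  have [n [m [yb ynp]]] := value_block p.+1.
  have [_ yn _ _] := yb; have [q ynq yn1] := cut_value y_dec yaM yn.
  have [a_dec a_range _] := yaM.
  have qp : q = p.+1.
    by apply/eqP; rewrite eqn_leq -!a_dec -ynq ynp lexx.
  have n0 : (0 < n)%N.
    rewrite lt0n; apply/eqP => n0; have [i _ yi] : range y (alpha p) by rewrite -a_range; exists p.
    have := y_dec 0%N i (leq0n i); rewrite yi -n0 ynp a_dec; lia.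
  have [_ yn1E] := yn1 n0; rewrite qp /= in yn1E.
  rewrite (block_multiplicity y_dec yaM yb ynp) -yn1E -ynp.
  by have [_ ] := irr n m yb; apply.
have [n [m [yb ynp]]] := value_block p.
by rewrite (block_multiplicity y_dec yaM yb ynp); have [] := irr n m yb.
Qed.

(** * Merging and splitting terms *)

(** [bump k] enumerates the indices other than [k]: deleting entry [k] of [x] leaves [z]. *)
Definition inserted (R : realType) (z : nat -> R) (v : R) (x : nat -> R) : Prop :=
  exists2 k, x k = v & forall i, x (bump k i) = z i.

Section Insertion.
Variable R : realType.
Implicit Types (x z w : nat -> R) (v : R).

Lemma esum_bump x z k A : (forall i, x (bump k i) = z i) ->
  (\esum_(i in bump k @` A) (x i)%:E = \esum_(i in A) (z i)%:E)%E.
Proof.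
move=> xz; rewrite esum_image; last by move=> i j _ _; apply: (can_inj (bumpK k)).
by apply: eq_esum => i _; rewrite xz.
Qed.

Lemma bump_image_preimage k A : ~ A k -> bump k @` (bump k @^-1` A) = A.
Proof.
move=> nAk; apply/seteqP; split=> [_ [i Ai <-//]|i Ai].
have ik : i != k by apply/eqP => E; rewrite E in Ai.
by exists (unbump k i); rewrite /= unbumpK.
Qed.

Lemma range_bump k : range (bump k) = ~` [set k].
Proof.
rewrite -(@bump_image_preimage k (~` [set k])); last by move=> nk; apply: nk.
congr image; apply/seteqP; split=> i //= _ /eqP.
by rewrite eq_sym (negbTE (neq_bump k i)).
Qed.

Lemma inserted_pos_summable z v x : inserted z v x -> 0 < v ->
  pos_summable z <-> pos_summable x.
Proof.
move=> [k xk xz] v0; rewrite /pos_summable /positive_seq.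
have esum_z : \esum_(i in [set: nat]) (z i)%:E =
    \esum_(i in ~` [set k]) (x i)%:E by rewrite -range_bump (esum_bump _ xz).
have pos_xz : (forall i, 0 < x i) <-> (forall i, 0 < z i).
  split=> [x0 i|z0 i]; first by rewrite -xz.
  have [->|ik] := eqVneq i k; first by rewrite xk.
  by rewrite -(unbumpK ik) xz.
split=> -[/pos_xz x0 fin]; split=> //; have x_ge0 i : (0 <= (x i)%:E)%E.
- by rewrite lee_fin ltW.
- rewrite (esumID [set k]) // !setTI -esum_z esum_set1 //.
  by apply: lte_add_pinfty => //; apply: ltry.
- by rewrite lee_fin ltW //; move: i; apply/pos_xz.
- rewrite esum_z; apply: le_lt_trans fin; rewrite [leRHS](esumID [set k]) // !setTI.
  by rewrite leeDr // esum_ge0.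
Qed.

Lemma inserted_tail_subsums z v x s : inserted z v x -> pos_summable x ->
  tail_subsums x 0 s <-> tail_subsums z 0 s \/ tail_subsums z 0 (s - v).
Proof.
move=> [k xk xz] x_ps.
have subz A : subsum x (bump k @` A) = subsum z A by rewrite /subsum (esum_bump _ xz).
have nk A : ~ (bump k @` A) k by move=> [i _ /eqP]; rewrite eq_sym (negbTE (neq_bump k i)).
split=> [[A _ ->]|[[A _ ->]|[A _ sA]]].
- have [Ak|nAk] := pselect (A k); [right|left].
    rewrite (subsum_mem x_ps Ak) xk addrC addKr -(@bump_image_preimage k (A `\ k)); last by case=> _; apply.
    by rewrite subz; exists (bump k @^-1` (A `\ k)).
  by rewrite -(bump_image_preimage nAk) subz; exists (bump k @^-1` A).
- by exists (bump k @` A); rewrite ?subz.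
- exists (k |` bump k @` A) => //; rewrite subsum_add // subz xk -sA; ring.
Qed.

Lemma inserted_total z v x : inserted z v x -> pos_summable x ->
  subsum x [set: nat] = v + subsum z [set: nat].
Proof.
move=> [k xk xz] x_ps; rewrite (@subsum_mem _ _ x_ps _ k) // xk setTD -range_bump.
by rewrite /subsum (esum_bump _ xz).
Qed.

Lemma sorted_insertion z v : pos_summable z -> nonincreasing_seq z -> 0 < v ->
  exists2 x, inserted z v x & nonincreasing_seq x.
Proof.
move=> z_ps z_dec v0; have [k [zge zlt]] := first_below z_ps z_dec v0.
exists (fun i => if i == k then v else z (unbump k i)).
  exists k => [|i]; first by rewrite eqxx.
  by rewrite eq_sym (negbTE (neq_bump k i)) bumpK.
apply/nonincreasing_seqP => i; rewrite /unbump.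
have [->|ik] := eqVneq i k.
  by rewrite (negbTE (_ : k.+1 != k)) ?ltnS ?leqnn ?subn1 /= ?ltW ?zlt //; lia.
have [E|ik1] := eqVneq i.+1 k.
  by rewrite zge; lia.
by apply: z_dec; lia.
Qed.

Lemma inserted_min z v x c : inserted z v x ->
  inserted (fun i => Num.min (z i) c) (Num.min v c) (fun i => Num.min (x i) c).
Proof. by move=> [k xk xz]; exists k => [|i]; rewrite ?xk ?xz. Qed.

Lemma pos_summable_min x c : 0 < c -> pos_summable x ->
  pos_summable (fun i => Num.min (x i) c).
Proof.
move=> c0 [x0 x_fin]; split=> [i|]; first by rewrite lt_min x0.
apply: le_lt_trans x_fin; apply: le_esum => i _.
by rewrite lee_fin ge_min lexx.
Qed.

(* If a subsum of [z] already uses the whole run, adding [v] amounts to removing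
   the run and adding [(m + 1) v]; if it meets the run, adding [m v] amounts to
   removing one term of the run and adding [(m + 1) v]. *)
Lemma merge_tail_subsums z x1 x2 w v c m : (0 < m)%N ->
  (forall i, (c <= i < c + m)%N -> z i = v) ->
  inserted z (m%:R * v) x1 -> inserted x1 v x2 -> inserted z (m.+1%:R * v) w ->
  pos_summable x2 -> pos_summable x1 -> pos_summable z -> pos_summable w ->
  tail_subsums x2 0 = tail_subsums w 0.
Proof.
move=> m0 zv zx1 x1x2 zw x2_ps x1_ps z_ps w_ps.
have mE : m.+1%:R * v = m%:R * v + v by rewrite -natr1 mulrDl mul1r.
pose run := [set i | (c <= i < c + m)%N].
have sub_run : subsum z run = m%:R * v := subsum_run z_ps zv.
have add_v s : tail_subsums z 0 s ->
    tail_subsums z 0 (s + v) \/ tail_subsums z 0 (s + v - m.+1%:R * v).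
  move=> [A _ ->]; have [run_A|] := pselect (run `<=` A).
    right; exists (A `\` run) => //.
    rewrite (subsumD z_ps run_A) sub_run mE; ring.
  move=> /existsNP[i /not_implyP[ri nAi]]; left; exists (i |` A) => //.
  by rewrite subsum_add // zv // addrC.
have add_mv s : tail_subsums z 0 s ->
    tail_subsums z 0 (s + m%:R * v) \/ tail_subsums z 0 (s + m%:R * v - m.+1%:R * v).
  move=> [A _ ->]; have [run_A|] := pselect (exists i, A i /\ run i).
    move: run_A => [i [Ai ri]]; right; exists (A `\ i) => //.
    rewrite (subsum_mem z_ps Ai) zv // mE; ring.
  move=> /forallNP nrun; left; exists (A `|` run) => //; rewrite subsumU // ?sub_run //.
  by apply/seteqP; split=> i // [Ai ri]; apply: (nrun i).
have x2P s := inserted_tail_subsums s x1x2 x2_ps.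
have x1P s := inserted_tail_subsums s zx1 x1_ps.
have wP s := inserted_tail_subsums s zw w_ps.
apply/seteqP; split=> s.
  move=> /x2P[/x1P[Fs|Fs]|/x1P[Fs|Fs]]; apply/wP.
  - by left.
  - by have := add_mv _ Fs; rewrite !subrK.
  - by have := add_v _ Fs; rewrite !subrK.
  - right; rewrite mE; suff <- : s - v - m%:R * v = s - (m%:R * v + v) by []; ring.
move=> /wP[Fs|Fs]; apply/x2P; [left|right]; apply/x1P; [left|right] => //.
by move: Fs; rewrite mE; suff <- : s - v - m%:R * v = s - (m%:R * v + v) by []; ring.
Qed.

(** Truncating all terms at [v] makes the totals differ: the two inserted terms contribute [2 v],
    the merged one only [v]. *)
Lemma merge_neq z x1 x2 w v m : (0 < m)%N -> 0 < v ->
  inserted z (m%:R * v) x1 -> inserted x1 v x2 -> inserted z (m.+1%:R * v) w ->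
  pos_summable x2 -> x2 <> w.
Proof.
move=> m0 v0 zx1 x1x2 zw x2_ps x2w.
have mv0 k : (0 < k)%N -> Num.min (k%:R * v) v = v.
  by move=> k0; apply/min_idPr; rewrite ler_peMl ?ler1n // ltW.
have ps2 := pos_summable_min v0 x2_ps.
have := inserted_total (inserted_min v zw) _; rewrite -x2w mv0 // => /(_ ps2).
rewrite (inserted_total (inserted_min v x1x2) ps2) minxx.
have ps1 : pos_summable (fun i => Num.min (x1 i) v).
  have /inserted_pos_summable := inserted_min v x1x2; rewrite minxx => H.
  by apply/H.
rewrite (inserted_total (inserted_min v zx1) ps1) mv0 //; lra.
Qed.

Lemma inserted_bump x k : inserted (x \o bump k) (x k) x.
Proof. by exists k. Qed.

Lemma nonincreasing_bump x k : nonincreasing_seq x -> nonincreasing_seq (x \o bump k).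
Proof. by move=> x_dec i j ij; apply: x_dec; rewrite leq_bump2. Qed.

End Insertion.

(** * Necessity, and the equivalence *)

Lemma irreducible_of_unique (R : realType) (y : nat -> R) n m :
  pos_summable y -> nonincreasing_seq y -> uniquely_achievable y -> block y n m ->
  (m <= 2)%N /\ ((0 < n)%N -> y n.-1 <> m.+1%:R * y n).
Proof.
move=> y_ps y_dec uniq_y [m0 yn ybn _].
have v0 : 0 < y n by case: y_ps => + _; apply.
have unique x : pos_summable x -> nonincreasing_seq x -> x <> y ->
    tail_subsums x 0 = tail_subsums y 0 -> False.
  move=> x_ps x_dec xy Exy; apply: uniq_y; exists x; split=> //.
    exact/summable_positive_nonincP.
  by rewrite !eq_achievement_set.
split=> [|n0 yn1].
  rewrite leqNgt; apply/negP => m3; set v := y n in v0 *.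
  (* Two of at least three equal terms are deleted; another one moves to index [n] of [z] and serves
     as the run of length 1 for merging. *)
  pose x1 := y \o bump n; pose z := x1 \o bump n.
  have yx1 : inserted x1 v y := inserted_bump y n.
  have x1z : inserted z (1%:R * v) x1.
    rewrite mul1r (_ : v = x1 n); first exact: inserted_bump.
    by rewrite /x1 /= /bump leqnn ybn //; lia.
  have x1_ps : pos_summable x1 by apply/(inserted_pos_summable yx1).
  have z_ps : pos_summable z by apply/(inserted_pos_summable x1z); rewrite ?mul1r.
  have v20 : 0 < 2%:R * v by rewrite mulr_gt0.
  have z_dec : nonincreasing_seq z by do 2 apply: nonincreasing_bump.
  have [w zw w_dec] := sorted_insertion z_ps z_dec v20.
  have w_ps : pos_summable w by apply/(inserted_pos_summable zw).
  apply: (unique w) => //.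
    by apply/nesym/(merge_neq (ltn0Sn 0) v0 x1z yx1 zw).
  apply/esym/(merge_tail_subsums (ltn0Sn 0) (c := n) _ x1z yx1 zw) => // i ni.
  have -> : i = n by lia.
  by rewrite /z /x1 /= /bump leqnn ybn //; lia.
(* Deleting the term [(m + 1) v] shifts the block to start at [n.-1], where it is the run of length
   [m] needed for splitting. *)
set v := y n in yn1 v0; pose z := y \o bump n.-1.
have zy : inserted z (m.+1%:R * v) y by rewrite -yn1; apply: inserted_bump.
have u0 : 0 < m.+1%:R * v by rewrite mulr_gt0.
have mv0 : 0 < m%:R * v by rewrite mulr_gt0 ?ltr0n.
have z_ps : pos_summable z by apply/(inserted_pos_summable zy).
have z_dec : nonincreasing_seq z by apply: nonincreasing_bump.
have [x1 zx1 x1_dec] := sorted_insertion z_ps z_dec mv0.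
have x1_ps : pos_summable x1 by apply/(inserted_pos_summable zx1).
have [x2 x12 x2_dec] := sorted_insertion x1_ps x1_dec v0.
have x2_ps : pos_summable x2 by apply/(inserted_pos_summable x12).
apply: (unique x2) => //; first exact: merge_neq m0 v0 zx1 x12 zy x2_ps.
apply: (merge_tail_subsums m0 (c := n.-1) _ zx1 x12 zy) => // i ni.
by rewrite /z /= /bump ybn //; lia.
Qed.

Theorem theorem5 (R : realType) (y alpha : nat -> R) (M : nat -> nat)
    (y_semi_fast : semi_fast y)
    (y_alphaM : values_multiplicities y alpha M) :
  uniquely_achievable y <->
  irreducible_seq alpha M /\ (forall n : nat, (M n <= 2)%N).
Proof.
rewrite (irreducible_blocksP y_semi_fast y_alphaM).
have [y_ps y_dec y_fast] := semi_fastP y_semi_fast.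
split=> [uniq_y n m|irr [x [/summable_positive_nonincP[x_ps x_dec] xy]]].
  exact: irreducible_of_unique.
rewrite !eq_achievement_set // => Exy; apply: xy.
exact: unique_of_irreducible.
Qed.
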